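(* Let $d\ge 3$ be an integer and let $G$ be a finite, $d$-regular, vertex-transitive graph whose adjacency matrix has least eigenvalue $\lambda_{\min}$. Then the independence ratio of $G$ is at least $$\frac12-\frac13\sqrt{d(\lambda_{\min}+d)}.$$ In particular, for fixed $d$, if $(G_n)$ is a sequence of such graphs whose least eigenvalues $\lambda_{\min}(G_n)$ converge to $-d$, then the independence ratios of $G_n$ converge to $1/2$.
   Context: Graphs are simple and undirected. An independent set is a set of vertices no two of which are adjacent. The independence ratio of a finite graph is the size of its largest independent set divided by its number of vertices. A graph is vertex-transitive if its automorphism group acts transitively on its vertex set. *)

(* Defs.v *)
From HB Require Import structures.
From mathcomp Require Import all_boot all_order all_algebra all_fingroup.
From mathcomp Require Import reals.

Set Implicit Arguments.
Unset Strict Implicit.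
Unset Printing Implicit Defensive.

Import Order.TTheory GRing.Theory Num.Theory.

Record sgraph := SGraph {
  vertex :> finType;
  adj : rel vertex;
  adj_sym : symmetric adj;
  adj_irr : irreflexive adj
}.

Section Graphs.
Local Open Scope nat_scope.
Variable G : sgraph.

Definition regular (d : nat) : Prop :=
  forall x : G, #|[set y | adj x y]| = d.

Definition graph_aut : {set {perm G}} :=
  [set s : {perm G} | [forall x, forall y, adj (s x) (s y) == adj x y]].

Lemma graph_autP (s : {perm G}) :
  reflect (forall x y, adj (s x) (s y) = adj x y) (s \in graph_aut).
Proof.
rewrite inE; apply: (iffP forallP) => [h x y|h x].
  by apply/eqP; move/forallP: (h x).
by apply/forallP => y; rewrite h.
Qed.

Lemma graph_aut_group_set : group_set graph_aut.
Proof.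
apply/group_setP; split => [|s t /graph_autP hs /graph_autP ht].
  by apply/graph_autP => x y; rewrite !perm1.
by apply/graph_autP => x y; rewrite !permM ht hs.
Qed.

Canonical graph_aut_group := Group graph_aut_group_set.

(* [transitive _, on S | _] is false when S is empty, so the graph without
   vertices is not vertex-transitive. *)
Definition vertex_transitive : bool :=
  [transitive graph_aut, on [set: G] | 'P].

Definition independent (A : {set G}) : bool :=
  [forall x in A, forall y in A, ~~ adj x y].

Definition indep_number : nat := \max_(A : {set G} | independent A) #|A|.

End Graphs.

Section Spectrum.
Local Open Scope ring_scope.
Variable R : realType.

Definition indep_ratio (G : sgraph) : R := (indep_number G)%:R / #|G|%:R.

(* Vertices are numbered by the enumeration of the vertex type; another
   numbering gives a similar matrix. *)
Definition adjmx (G : sgraph) : 'M[R]_#|G| :=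
  \matrix_(i, j) (adj (enum_val i : G) (enum_val j))%:R.

(* Only real eigenvalues are considered, which is all of them when A is
   symmetric. *)
Definition least_eigenvalue (n : nat) (A : 'M[R]_n) (lam : R) : Prop :=
  eigenvalue A lam /\ forall a : R, eigenvalue A a -> lam <= a.

End Spectrum.

(* Main.v *)
Require Import Defs.
From HB Require Import structures.
From mathcomp Require Import all_boot all_order all_algebra all_fingroup.
From mathcomp Require Import ring lra.
Import Order.TTheory GRing.Theory Num.Theory.

(* Let f be an eigenvector for lam, let mu = lam + d, and write N(v) for the set
   of neighbours of v and N[v] for N(v) with v added. Draw a random automorphism
   s and a random sign, and let S be the set where the positive part of
   +-(f o s) exceeds a threshold whose square is uniform. Process independent
   copies of S one after the other; v is decided at the first S meeting N[v],
   and is selected if that S meets N[v] in v alone. The selected vertices form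
   an independent set, and v is selected with probability
   P(S meets N[v] but not N(v)) / P(S meets N[v]). The two probabilities are,
   up to a common factor, expectations of maxima of the square of the positive
   part of +-(f o s), and by transitivity these are averages over the vertices.
   They are compared vertex by vertex with f(x)^2 and
   Q(x) = sum over u in N(x) of (f(u) + f(x))^2, using that the numbers
   f(u) + f(x), u in N(x), add up to mu f(x); finally
   sum Q = 2 mu sum f^2. *)

Local Open Scope ring_scope.

(** * Cauchy-Schwarz, maxima and weights on superlevel sets *)

Lemma sqr_sum_le {R : realFieldType} {T : finType} (A : {set T}) (F : T -> R) :
  (\sum_(i in A) F i) ^+ 2 <= #|A|%:R * \sum_(i in A) F i ^+ 2.
Proof.
set s := \sum_(i in A) F i; set q := \sum_(i in A) F i ^+ 2.
have [A0|A0] := eqVneq #|A| 0%N.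
  by rewrite /s big_pred0 ?A0 ?mul0r ?expr0n // => i; have := card0_eq A0 i.
have k_gt0 : 0 < #|A|%:R :> R by rewrite ltr0n lt0n.
have : 0 <= \sum_(i in A) (#|A|%:R * F i - s) ^+ 2.
  by apply: sumr_ge0 => i _; rewrite sqr_ge0.
have sq i : (#|A|%:R * F i - s) ^+ 2
    = #|A|%:R ^+ 2 * F i ^+ 2 - (2 * #|A|%:R * s) * F i + s ^+ 2 by ring.
rewrite (eq_bigr _ (fun i _ => sq i)).
rewrite big_split sumrB /= sumr_const -(mulr_natl (s ^+ 2)) -!mulr_sumr -/s -/q.
rewrite (_ : _ + _ = #|A|%:R * (#|A|%:R * q - s ^+ 2)); last by ring.
by rewrite pmulr_rge0 // subr_ge0.
Qed.

(** The default 0 makes the maximum over the empty set 0, matching the weight of the sets that meet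
    the empty set. *)
Definition max_on {R : realFieldType} {T : finType} (h : T -> R) (A : {set T}) : R := \big[Num.max/0]_(x in A) h x.

Lemma max_on_ge0 {R : realFieldType} {T : finType} (h : T -> R) (A : {set T}) : 0 <= max_on h A.
Proof. exact: bigmax_ge_id. Qed.

Lemma max_on_cases {R : realFieldType} {T : finType} (h : T -> R) (A : {set T}) :
  max_on h A = 0 \/ exists2 x, x \in A & max_on h A = h x.
Proof.
rewrite /max_on; elim/big_ind: _ => [|u v Hu Hv|x xA]; first by left.
  by rewrite /Num.max; case: ifP.
by right; exists x.
Qed.

Lemma max_onU1 {R : realFieldType} {T : finType} (h : T -> R) (x : T) (A : {set T}) : 0 <= h x ->
  max_on h (x |: A) = Num.max (h x) (max_on h A).
Proof.
move=> hx; apply/eqP; rewrite eq_le; apply/andP; split.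
  apply/bigmax_leP; split=> [|y]; first by rewrite le_max hx.
  rewrite !inE => /orP[/eqP->|yA]; first by rewrite le_max lexx.
  by rewrite le_max le_bigmax_cond ?orbT.
rewrite ge_max le_bigmax_cond ?setU11 //=; apply/bigmax_leP; split=> [|y yA].
  exact: max_on_ge0.
by apply: le_bigmax_cond; rewrite setU1r.
Qed.

(** [p] is the unnormalised law of the superlevel set of [h] at a uniform threshold: that set meets
    [A] exactly when the threshold is below the maximum on [A]. Induction on the support of [h]
    peels off the bottom layer, the whole support [B] weighted by the least positive value [h z]. *)
Lemma layer_cake {R : realFieldType} {T : finType} (h : T -> R) : (forall x, 0 <= h x) ->
  exists2 p : {set T} -> R, (forall S, 0 <= p S) &
    forall A : {set T}, \sum_(S : {set T} | ~~ [disjoint S & A]) p S = max_on h A.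
Proof.
have [n] := ubnP #|[set x | 0 < h x]|; elim: n h => // n IHn h.
set B := [set x | 0 < h x] => Bn h_ge0.
have [B0|[x0 x0B]] := set_0Vmem B.
  exists (fun=> 0) => // A; rewrite big1 // /max_on; apply/esym.
  apply/eqP; rewrite eq_le max_on_ge0 andbT; apply/bigmax_leP; split=> // x _.
  by have : x \notin B; [rewrite B0 inE | rewrite inE -leNgt].
pose z := [arg min_(x < x0 in B) h x]%O.
have [zB zmin] : z \in B /\ forall x, x \in B -> h z <= h x.
  by rewrite /z; case: arg_minP => // i iB imin; split.
have hz : 0 < h z by move: zB; rewrite inE.
pose h' x := if x \in B then h x - h z else 0.
have hE x : h x = h' x + h z * (x \in B)%:R.
  rewrite /h'; case: ifPn => xB; first by rewrite mulr1 subrK.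
  by rewrite mulr0 addr0; apply/eqP; rewrite eq_le h_ge0 leNgt; move: xB; rewrite inE => ->.
have h'_ge0 x : 0 <= h' x by rewrite /h'; case: ifP => // xB; rewrite subr_ge0 zmin.
have [|p p_ge0 pE] := IHn h' _ h'_ge0.
  apply: (@leq_trans #|B|) => //; apply: proper_card; apply/properP; split.
    apply/subsetP => x; rewrite inE /h'; case: ifP => //; by rewrite ltxx.
  by exists z => //; rewrite inE /h' zB subrr ltxx.
exists (fun S => p S + h z * (S == B)%:R) => [S|A].
  by rewrite addr_ge0 // mulr_ge0 // ltW.
rewrite big_split /= pE -mulr_sumr.
have -> : \sum_(S : {set T} | ~~ [disjoint S & A]) (S == B)%:R
    = (~~ [disjoint B & A])%:R :> R.
  rewrite big_mkcond (bigD1 B) //= eqxx big1 ?addr0; first by case: ifP.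
  by move=> S /negPf->; case: ifP.
apply/eqP; rewrite eq_le; apply/andP; split.
  case: (boolP [disjoint B & A]) => BA; rewrite ?mulr0 ?addr0 ?mulr1.
    apply/bigmax_leP; split=> [|x xA]; first exact: max_on_ge0.
    apply: le_trans (le_bigmax_cond _ _ xA); rewrite [leRHS]hE lerDl.
    by rewrite mulr_ge0 // ltW.
  (* If the maximum of [h'] on [A] is 0 or is attained outside [B], it vanishes, and any point of
     [B] in [A] supplies the bound [h z]. *)
  have [E|[x xA E]] := max_on_cases h' A.
    have /pred0Pn[x /andP[/= xB xA]] := BA.
    by rewrite E add0r; apply: le_trans (le_bigmax_cond _ _ xA); apply: zmin.
  case: (boolP (x \in B)) => xB.
    by rewrite E; apply: le_trans (le_bigmax_cond _ _ xA); rewrite [leRHS]hE xB mulr1.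
  rewrite E /h' (negPf xB) add0r.
  have /pred0Pn[y /andP[/= yB yA]] := BA.
  by apply: le_trans (le_bigmax_cond _ _ yA); apply: zmin.
apply/bigmax_leP; split=> [|x xA].
  by rewrite addr_ge0 ?max_on_ge0 // mulr_ge0 // ltW.
rewrite hE lerD ?le_bigmax_cond // ler_pM2l // ler_nat.
by case: (boolP (x \in B)) => // xB; rewrite lt0b; apply/pred0Pn; exists x; rewrite /= xB.
Qed.

(** * Real inequalities for one vertex *)

(* Semidefinite only thanks to the exact constants: the discriminant vanishes at
   t = 1, for every k. *)
Lemma quadratic_form_ge0 {R : realFieldType} (t k m W : R) :
  0 < t -> t < 1 -> 2 <= k ->
  0 <= (1 + t) * (1 + t * (k ^+ 2 - 1)) * m ^+ 2
       - 2 * (k * (1 + t)) * (W * m)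
       + (k ^+ 2 * (1 - t) + 2 * t) * W ^+ 2.
Proof.
move=> t_gt0 t_lt1 k_ge2.
have k2 : 4 <= k ^+ 2 by nra.
have tk : 0 <= t * (k ^+ 2 - 1) by rewrite mulr_ge0 ?subr_ge0 ?(ltW t_gt0) //; lra.
have : 0 < (1 + t) * (1 + t * (k ^+ 2 - 1)) by rewrite mulr_gt0 ?ltr_pwDl ?ltr01 ?(ltW t_gt0).
set A := (1 + t) * _; set B := k * _; set C := _ + 2 * t => A_gt0.
have disc : A * C - B ^+ 2 = (1 + t) * t * (1 - t) * (k ^+ 2 - 1) * (k ^+ 2 - 2).
  by rewrite /A /B /C; ring.
rewrite -(pmulr_rge0 _ A_gt0).
rewrite [leRHS](_ : _ = (A * m - B * W) ^+ 2 + (A * C - B ^+ 2) * W ^+ 2); last by ring.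
rewrite addr_ge0 ?sqr_ge0 // mulr_ge0 ?sqr_ge0 // disc.
by rewrite !mulr_ge0 //; lra.
Qed.

(* At a vertex with f = a >= 0, x is the largest value of f on the neighbours
   and - (a + m) the smallest, Q is the sum of (f(u) + a)^2 over the D
   neighbours u. The numbers f(u) + a sum to mu a; the hypothesis on Q is
   Cauchy-Schwarz for the D - 2 neighbours that are not extremal. *)
Lemma local_inequality_two {R : realFieldType} (t D mu a x m Q : R) :
  0 < t -> t < 1 -> 3 <= D -> 0 <= mu -> mu <= 1 ->
  0 <= a -> 0 <= x -> 0 <= m ->
  (D - 2) * ((a + x) ^+ 2 + m ^+ 2) + (a + x - m - mu * a) ^+ 2 <= (D - 2) * Q ->
  2 * t * x ^+ 2 + t * (1 - t) * (a + m) ^+ 2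
    <= t * (1 - t ^+ 2) * a ^+ 2 + (1 + t) * (Q * (D - 1) / D).
Proof.
move=> t_gt0 t_lt1 D_ge3 mu_ge0 mu_le1 a0 x0 m0 HQ.
(* [W] is what the neighbours other than the lowest need in total beyond [m]: as [x <= W <= a + x],
   the data reduce to [W] and [m]. *)
pose k := D - 1; pose W := a + x - mu * a.
have mua : mu * a <= a by nra.
have mua0 : 0 <= mu * a by nra.
have xW : x <= W by rewrite /W; lra.
have k_ge2 : 2 <= k by rewrite /k; lra.
have HQ' : (D - 2) * (W ^+ 2 + m ^+ 2) + (W - m) ^+ 2 <= (D - 2) * Q.
  apply: le_trans HQ.
  rewrite (_ : W - m = a + x - m - mu * a); last by rewrite /W; ring.
  rewrite lerD2r ler_wpM2l //; first by lra.
  by rewrite lerD2r ler_sqr ?nnegrE; rewrite /W; lra.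
set q := Q * (D - 1) / D.
(* Here [k ^+ 2 - 1 = D * (D - 2)], which clears the denominator of [q]; the lower bound is [k]
   times the left side of [HQ'], with a square completed. *)
have Hq : (k ^+ 2 - 1) * q >= (k ^+ 2 - 1) * m ^+ 2 + (k * W - m) ^+ 2.
  have -> : (k ^+ 2 - 1) * q = (D - 2) * Q * k.
    by rewrite /q /k; field; lra.
  apply: le_trans (ler_wpM2r _ HQ'); last by lra.
  by rewrite le_eqVlt; apply/orP; left; apply/eqP; rewrite /k; ring.
have kk : 0 < k ^+ 2 - 1 by nra.
have := quadratic_form_ge0 t k m W t_gt0 t_lt1 k_ge2.
have x2 : x ^+ 2 <= W ^+ 2 by rewrite ler_sqr ?nnegrE //; lra.
have x2' : 2 * t * x ^+ 2 <= 2 * t * W ^+ 2 by rewrite ler_pM2l //; lra.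
move=> form.
(* After multiplication by [k ^+ 2 - 1], the gap between the bound from [Hq] and the left side is
   exactly the quadratic form. *)
have key : (1 - t ^+ 2) * m ^+ 2 + 2 * t * W ^+ 2 <= (1 + t) * q.
  rewrite -(ler_pM2l kk).
  have H1 : (1 + t) * ((k ^+ 2 - 1) * m ^+ 2 + (k * W - m) ^+ 2) <= (1 + t) * ((k ^+ 2 - 1) * q).
    by rewrite ler_pM2l //; lra.
  rewrite [leRHS]mulrCA; apply: le_trans H1; rewrite -subr_ge0.
  by apply: (le_trans form); rewrite le_eqVlt; apply/orP; left; apply/eqP; ring.
(* This is exactly the excess of [(1 - t ^+ 2) * m ^+ 2] over [t * (1 - t) * (a + m) ^+ 2 - t * (1 -
   t ^+ 2) * a ^+ 2]. *)
have sq : 0 <= (1 - t) * (t * a - m) ^+ 2 by rewrite mulr_ge0 ?sqr_ge0 //; lra.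
rewrite -subr_ge0.
rewrite [leRHS](_ : _ = (1 - t) * (t * a - m) ^+ 2
   + ((1 + t) * q - ((1 - t ^+ 2) * m ^+ 2 + 2 * t * W ^+ 2))
   + (2 * t * W ^+ 2 - 2 * t * x ^+ 2)); last by ring.
by rewrite addr_ge0 ?subr_ge0 // addr_ge0 ?subr_ge0.
Qed.

(** The case without positive neighbours. Since [mu * a >= 0], Cauchy-Schwarz for the other [D - 1]
    neighbours gives [D * m ^+ 2 <= (D - 1) * Q]. *)
Lemma local_inequality_opp {R : realFieldType} (t D mu a m Q : R) :
  0 < t -> t < 1 -> 3 <= D -> 0 <= mu ->
  0 <= a -> 0 <= m ->
  (D - 1) * m ^+ 2 + (m + mu * a) ^+ 2 <= (D - 1) * Q ->
  t * (1 - t) * (a + m) ^+ 2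
    <= t * (1 - t ^+ 2) * a ^+ 2 + (1 + t) * (Q * (D - 1) / D).
Proof.
move=> t_gt0 t_lt1 D_ge3 mu_ge0 a0 m0 HQ.
have mua0 : 0 <= mu * a by nra.
have Hq : m ^+ 2 <= Q * (D - 1) / D.
  rewrite ler_pdivlMr; last by lra.
  rewrite [Q * _]mulrC; apply: le_trans HQ.
  have : m ^+ 2 <= (m + mu * a) ^+ 2 by rewrite ler_sqr ?nnegrE //; lra.
  lra.
set q := _ / D in Hq *.
have sq : 0 <= (1 - t) * (t * a - m) ^+ 2 by rewrite mulr_ge0 ?sqr_ge0 //; lra.
have tq : (1 + t) * m ^+ 2 <= (1 + t) * q by rewrite ler_pM2l //; lra.
have tm : 0 <= t * m ^+ 2 * (1 + t) by rewrite !mulr_ge0 ?sqr_ge0 //; lra.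
rewrite -subr_ge0.
rewrite [leRHS](_ : _ = (1 - t) * (t * a - m) ^+ 2
   + ((1 + t) * q - (1 + t) * m ^+ 2) + t * m ^+ 2 * (1 + t)); last by ring.
by rewrite addr_ge0 ?subr_ge0 // addr_ge0 ?subr_ge0.
Qed.

(** The case where no neighbour lies below [- a], so that [a ^+ 2] bounds the negative maximum.
    Since [mu <= 1], Cauchy-Schwarz gives [D * x ^+ 2 <= (D - 1) * Q]. *)
Lemma local_inequality_same {R : realFieldType} (t D mu a x Q : R) :
  0 < t -> t < 1 -> 3 <= D -> mu <= 1 ->
  0 <= a -> 0 <= x ->
  (D - 1) * (a + x) ^+ 2 + (a + x - mu * a) ^+ 2 <= (D - 1) * Q ->
  2 * t * x ^+ 2 + t * (1 - t) * a ^+ 2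
    <= t * (1 - t ^+ 2) * a ^+ 2 + (1 + t) * (Q * (D - 1) / D).
Proof.
move=> t_gt0 t_lt1 D_ge3 mu_le1 a0 x0 HQ.
have mua : mu * a <= a by nra.
have Hq : x ^+ 2 <= Q * (D - 1) / D.
  rewrite ler_pdivlMr; last by lra.
  rewrite [Q * _]mulrC; apply: le_trans HQ.
  have H1 : x ^+ 2 <= (a + x - mu * a) ^+ 2 by rewrite ler_sqr ?nnegrE //; lra.
  have H2 : x ^+ 2 <= (a + x) ^+ 2 by rewrite ler_sqr ?nnegrE //; lra.
  have : (D - 1) * x ^+ 2 <= (D - 1) * (a + x) ^+ 2 by rewrite ler_pM2l //; lra.
  lra.
set q := _ / D in Hq *.
have tq : (1 + t) * x ^+ 2 <= (1 + t) * q by rewrite ler_pM2l //; lra.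
have H3 : 0 <= (1 - t) * x ^+ 2 by rewrite mulr_ge0 ?sqr_ge0 //; lra.
have H4 : 0 <= t ^+ 2 * (1 - t) * a ^+ 2 by rewrite !mulr_ge0 ?sqr_ge0 //; lra.
rewrite -subr_ge0.
rewrite [leRHS](_ : _ = ((1 + t) * q - (1 + t) * x ^+ 2) + (1 - t) * x ^+ 2
   + t ^+ 2 * (1 - t) * a ^+ 2); last by ring.
by rewrite addr_ge0 ?subr_ge0 // addr_ge0 ?subr_ge0.
Qed.

(** * Independent sets from weighted random sets *)

Definition nbhd {G : sgraph} (x : G) : {set G} := [set y | adj x y].

Lemma independentP {G : sgraph} (A : {set G}) :
  reflect {in A &, forall x y, ~~ adj x y} (independent A).
Proof.
apply: (iffP forall_inP) => [h x y xA yA|h x xA].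
  by move/forall_inP: (h x xA); apply.
by apply/forall_inP => y yA; apply: h.
Qed.

Lemma indep_number_max {G : sgraph} (A : {set G}) :
  independent A -> (#|A| <= indep_number G)%N.
Proof. by move=> iA; rewrite /indep_number (bigD1 A) //= leq_maxl. Qed.

(** The random process, derandomised: [U] holds the undecided vertices, and each round picks a good
    [S] by averaging, keeps [sel S] and recurses on the vertices that [S] leaves undecided. *)
Lemma greedy_independent {R : realFieldType} {G : sgraph} (p : {set G} -> R) (r : R) :
  (forall S, 0 <= p S) ->
  (forall v : G, 0 < \sum_(S : {set G} | ~~ [disjoint S & v |: nbhd v]) p S) ->
  (forall v : G, r * \sum_(S : {set G} | ~~ [disjoint S & v |: nbhd v]) p S
     <= \sum_(S : {set G} | ~~ [disjoint S & v |: nbhd v]) p S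
        - \sum_(S : {set G} | ~~ [disjoint S & nbhd v]) p S) ->
  forall U : {set G},
    exists I : {set G}, [/\ I \subset U, independent I & r * #|U|%:R <= #|I|%:R].
Proof.
move=> p_ge0 rho_gt0 alpha_ge U.
have [n] := ubnP #|U|; elim: n U => // n IHn U Un.
have [U0|[v0 v0U]] := set_0Vmem U.
  exists set0; rewrite sub0set U0 cards0 mulr0; split=> //.
  by apply/independentP => x y; rewrite inE.
pose dec (S : {set G}) := [set v in U | ~~ [disjoint S & v |: nbhd v]].
pose sel (S : {set G}) := [set v in dec S | [disjoint S & nbhd v]].
have hit_nbhd (S : {set G}) (v : G) : ~~ [disjoint S & nbhd v] -> ~~ [disjoint S & v |: nbhd v].
  by apply: contra; apply: disjointWr; rewrite subsetUr.
have sel_mem (S : {set G}) v : v \in sel S -> v \in S.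
  rewrite !inE => /andP[/andP[_ /pred0Pn[w /andP[/= wS]]]].
  rewrite !inE => /orP[/eqP<- //|vw] dS.
  by have /pred0P/(_ w) := dS; rewrite /= wS inE vw.
have cardE (F : {set G} -> G -> bool) (S : {set G}) :
    #|[set v in U | F S v]|%:R = \sum_(v in U) (F S v)%:R :> R.
  rewrite -sum1_card natr_sum [RHS]big_mkcond [LHS]big_mkcond.
  by apply: eq_bigr => v _; rewrite inE; case: (v \in U); case: (F S v).
have sumE (F : {set G} -> G -> bool) :
    \sum_S p S * #|[set v in U | F S v]|%:R = \sum_(v in U) \sum_(S : {set G} | F S v) p S.
  under eq_bigr => S _ do rewrite cardE mulr_sumr.
  rewrite exchange_big; apply: eq_bigr => v _ /=; rewrite [RHS]big_mkcond.
  by apply: eq_bigr => S _; case: (F S v); rewrite ?mulr1 ?mulr0.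
(* An [S] meeting N(v) also meets N[v], so the selected vertices are counted by a difference. *)
have cardsel S : #|sel S|%:R = #|dec S|%:R - #|[set v in U | ~~ [disjoint S & nbhd v]]|%:R :> R.
  apply/eqP; rewrite eq_sym subr_eq -natrD eqr_nat.
  rewrite -(cardsID [set v | [disjoint S & nbhd v]] (dec S)).
  apply/eqP; congr (_ + _)%N; apply: eq_card => v; rewrite !inE.
    by [].
  by case: (boolP [disjoint S & nbhd v]) => /= [|/hit_nbhd ->]; rewrite ?andbF ?andbT.
(* Weighted by p, the selected vertices outnumber r times the decided ones; so
   some S that decides a vertex does at least as well as this average. *)
have avg : 0 <= \sum_S p S * (#|sel S|%:R - r * #|dec S|%:R).
  have -> : \sum_S p S * (#|sel S|%:R - r * #|dec S|%:R)
    = \sum_S (p S * #|dec S|%:R - p S * #|[set v in U | ~~ [disjoint S & nbhd v]]|%:R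
        - r * (p S * #|dec S|%:R)).
    by apply: eq_bigr => S _; rewrite cardsel; ring.
  rewrite !sumrB -mulr_sumr !sumE mulr_sumr -!sumrB.
  by apply: sumr_ge0 => v _; rewrite subr_ge0.
have [S S_dec S_sel] : exists2 S, dec S != set0 & r * #|dec S|%:R <= #|sel S|%:R.
  apply/exists_inP; apply: contraLR avg => /exists_inPn noS; rewrite -ltNge.
  have term_le S : p S * (#|sel S|%:R - r * #|dec S|%:R) <= 0.
    have [S0|S0] := eqVneq (dec S) set0.
      rewrite (_ : sel S = set0) ?S0 ?cards0 ?mulr0 ?subr0 ?mulr0 //.
      by apply/setP => v; rewrite inE S0 inE.
    by rewrite mulr_ge0_le0 // subr_le0 ltW // ltNge noS.
  (* The contradiction needs one strictly negative term: a set of positive weight that decides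
     [v0]. *)
  have [S hitS pS] : exists2 S : {set G}, ~~ [disjoint S & v0 |: nbhd v0] & 0 < p S.
    apply/exists_inP; apply: contraLR (rho_gt0 v0) => /exists_inPn noS'.
    by rewrite -leNgt sumr_le0 // => S /noS'; rewrite -leNgt.
  rewrite (bigD1 S) //= ltr_wnDr ?sumr_le0 // pmulr_rlt0 // subr_lt0 ltNge noS //.
  by apply/set0Pn; exists v0; rewrite inE v0U.
have [|I [IU iI cI]] := IHn (U :\: dec S).
  apply: (@leq_trans #|U|) => //; apply: proper_card.
  have [v vS] := set0Pn _ S_dec; apply/properP; split; first exact: subsetDl.
  by exists v; [move: vS; rewrite inE => /andP[] | rewrite inE vS].
have decU : dec S \subset U by apply/subsetP => v; rewrite inE => /andP[].
have seldec : sel S \subset dec S by apply/subsetP => v; rewrite inE => /andP[].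
(* A selected [x] belongs to [S], whereas [S] misses the closed neighbourhood of every [y] left for
   later rounds. *)
have cross x y : x \in sel S -> y \in I -> ~~ adj x y.
  move=> xS yI; apply/negP => xy.
  have := subsetP IU _ yI; rewrite !inE => /andP[+ yU]; rewrite yU /= negbK => dS.
  have /pred0P/(_ x) := dS; rewrite /= (sel_mem _ _ xS) !inE.
  by rewrite adj_sym xy orbT.
exists (sel S :|: I); split.
- rewrite subUset (subset_trans seldec decU) /=.
  by apply: subset_trans IU (subsetDl _ _).
- apply/independentP => x y; rewrite !in_setU => /orP[xS|xI] /orP[yS|yI].
  + apply/negP => xy.
    have := yS; rewrite inE => /andP[_ /pred0P/(_ x)].
    by rewrite /= (sel_mem _ _ xS) inE adj_sym xy.
  + exact: cross.
  + by rewrite adj_sym cross.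
  + by move/independentP: iI; apply.
rewrite cardsU (_ : sel S :&: I = set0) ?cards0 ?subn0.
  rewrite -(cardsID (dec S) U) (setIidPr decU) !natrD mulrDr.
  exact: lerD.
apply/setP => v; rewrite in_setI in_set0; apply/negP => /andP[vS vI].
by have := subsetP IU _ vI; rewrite in_setD (subsetP seldec _ vS).
Qed.

(** * Averaging over automorphisms *)

(** The image of [v] under a random automorphism is uniform: translating by an automorphism from [v]
    to [w] shows that the sum does not depend on [v], and then one sums over all vertices. *)
Lemma sum_graph_aut {R : realFieldType} {G : sgraph} (F : G -> R) (v : G) :
  vertex_transitive G ->
  #|G|%:R * \sum_(s in graph_aut G) F (s v) = #|graph_aut G|%:R * \sum_x F x.
Proof.
move=> trG.
have indep w : \sum_(s in graph_aut G) F (s w) = \sum_(s in graph_aut G) F (s v).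
  have [a aG ->] : exists2 a, a \in graph_aut G & w = a v.
    by have [a aG /= ->] := atransP2 trG (in_setT v) (in_setT w); exists a.
  rewrite (reindex_inj (mulgI a^-1%g)) /=.
  apply: eq_big => [s|s _]; first by rewrite groupMl ?groupV.
  by rewrite permM permK.
transitivity (\sum_(w : G) \sum_(s in graph_aut G) F (s w)).
  by rewrite (eq_bigr _ (fun w _ => indep w)) sumr_const mulr_natl.
rewrite exchange_big /= mulr_natl -sumr_const; apply: eq_bigr => s _.
by rewrite [RHS](reindex_inj (@perm_inj _ s)).
Qed.

Lemma nbhd_graph_aut {G : sgraph} (s : {perm G}) (x : G) :
  s \in graph_aut G -> nbhd (s x) = s @: nbhd x.
Proof.
move=> /graph_autP hs; apply/setP => y; rewrite inE -[y](permKV s) hs.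
by rewrite mem_imset ?inE //; exact: perm_inj.
Qed.

Lemma max_on_imset {R : realFieldType} {T : finType} (h : T -> R) (s : T -> T) (A : {set T}) :
  max_on h (s @: A) = max_on (h \o s) A.
Proof.
apply/eqP; rewrite eq_le; apply/andP; split; apply/bigmax_leP;
  split=> [|x xA]; rewrite ?max_on_ge0 //.
  by case/imsetP: xA => y yA ->; exact: (le_bigmax_cond _ (h \o s) yA).
exact: (le_bigmax_cond _ h (imset_f s xA)).
Qed.

(** * The rounding inequality at a vertex *)

Lemma sum_sqr_ge2 {R : realFieldType} {T : finType} (A : {set T}) (F : T -> R) (u v : T) :
  u \in A -> v \in A -> u != v ->
  (#|A|%:R - 2) * (F u ^+ 2 + F v ^+ 2) + (\sum_(w in A) F w - F u - F v) ^+ 2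
    <= (#|A|%:R - 2) * \sum_(w in A) F w ^+ 2.
Proof.
move=> uA vA uv.
have vAu : v \in A :\ u by rewrite !inE eq_sym uv.
have splitE (H : T -> R) :
    \sum_(w in A) H w = H u + (H v + \sum_(w in A :\ u :\ v) H w).
  by rewrite (big_setD1 u uA) (big_setD1 v vAu).
rewrite !splitE.
have := sqr_sum_le (A :\ u :\ v) F.
rewrite (_ : #|A :\ u :\ v|%:R = #|A|%:R - 2); last first.
  by rewrite (cardsD1 u A) uA (cardsD1 v (A :\ u)) vAu !natrD /=; ring.
move=> H; rewrite [F u ^+ 2 + (_ + _)]addrA [leRHS]mulrDr lerD2l.
apply: le_trans H.
by rewrite le_eqVlt; apply/orP; left; apply/eqP; congr (_ ^+ 2); ring.
Qed.

Lemma sum_sqr_ge1 {R : realFieldType} {T : finType} (A : {set T}) (F : T -> R) (u : T) :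
  u \in A ->
  (#|A|%:R - 1) * F u ^+ 2 + (\sum_(w in A) F w - F u) ^+ 2
    <= (#|A|%:R - 1) * \sum_(w in A) F w ^+ 2.
Proof.
move=> uA; have splitE (H : T -> R) : \sum_(w in A) H w = H u + \sum_(w in A :\ u) H w.
  exact: big_setD1.
rewrite !splitE.
have := sqr_sum_le (A :\ u) F.
rewrite (_ : #|A :\ u|%:R = #|A|%:R - 1); last first.
  by rewrite (cardsD1 u A) uA natrD /=; ring.
move=> H; rewrite [leRHS]mulrDr lerD2l; apply: le_trans H.
by rewrite le_eqVlt; apply/orP; left; apply/eqP; congr (_ ^+ 2); ring.
Qed.

(** Squared so that [layer_cake] makes the square of the threshold uniform. *)
Definition sqr_pos {R : realFieldType} (z : R) : R := Num.max 0 z ^+ 2.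

Lemma sqr_pos_ge0 {R : realFieldType} (z : R) : 0 <= sqr_pos z.
Proof. exact: sqr_ge0. Qed.

Lemma sqr_pos_ge {R : realFieldType} (z : R) : 0 <= z -> sqr_pos z = z ^+ 2.
Proof. by move=> z0; rewrite /sqr_pos max_r. Qed.

Lemma sqr_pos_le {R : realFieldType} (z : R) : z <= 0 -> sqr_pos z = 0.
Proof. by move=> z0; rewrite /sqr_pos max_l // expr0n. Qed.

Lemma max_sqr_pos_cases {R : realFieldType} {T : finType} (g : T -> R) (A : {set T}) :
  max_on (fun y => sqr_pos (g y)) A = 0 \/
  exists2 u, u \in A & 0 < g u /\ max_on (fun y => sqr_pos (g y)) A = g u ^+ 2.
Proof.
have [->|[u uA ->]] := max_on_cases (fun y => sqr_pos (g y)) A; first by left.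
have [gu|gu] := leP (g u) 0; first by left; rewrite sqr_pos_le.
by right; exists u; rewrite // sqr_pos_ge // ltW.
Qed.

(** The share of [x] in the quadratic form of the signless Laplacian; the sum over all vertices is
    twice that form. *)
Definition edge_energy {R : realFieldType} {G : sgraph} (g : G -> R) (x : G) : R :=
  \sum_(u in nbhd x) (g u + g x) ^+ 2.

(** The three local inequalities cover the cases according to whether some neighbour is positive and
    whether some neighbour lies below [- g x]; if neither happens, the bound is immediate. *)
Lemma vertex_inequality {R : realFieldType} {G : sgraph} (d : nat) (mu t : R)
    (g : G -> R) (x : G) :
  (3 <= d)%N -> regular G d -> 0 < t -> t < 1 -> 0 <= mu -> mu <= 1 -> 0 <= g x ->
  \sum_(u in nbhd x) g u = (mu - d%:R) * g x ->
  2 * t * max_on (fun y => sqr_pos (g y)) (nbhd x)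
    + t * (1 - t) * max_on (fun y => sqr_pos (- g y)) (nbhd x)
  <= t * (1 - t ^+ 2) * g x ^+ 2
     + (1 + t) * (edge_energy g x * (d%:R - 1) / d%:R).
Proof.
move=> d3 reg t0 t1 mu0 mu1 a0 eig.
have D3 : 3 <= d%:R :> R by rewrite ler_nat.
have cardN : #|nbhd x| = d by exact: reg.
pose F u := g u + g x.
have sumF : \sum_(u in nbhd x) F u = mu * g x.
  rewrite big_split /= eig sumr_const cardN -(mulr_natl (g x)); ring.
have := @sum_sqr_ge2 _ _ (nbhd x) F; have := @sum_sqr_ge1 _ _ (nbhd x) F.
rewrite cardN sumF -/(edge_energy g x) => one two.
have Q0 : 0 <= edge_energy g x * (d%:R - 1) / d%:R.
  by rewrite !mulr_ge0 ?invr_ge0 ?subr_ge0 ?sumr_ge0 // => [u _|]; [exact: sqr_ge0 | lra].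
have [M'le|[v vN [gv M'E]]] :
    max_on (fun y => sqr_pos (- g y)) (nbhd x) <= g x ^+ 2 \/
    exists2 v, v \in nbhd x & g x < - g v /\
      max_on (fun y => sqr_pos (- g y)) (nbhd x) = (- g v) ^+ 2.
- have [->|[v vN [gv ->]]] := max_sqr_pos_cases (fun y => - g y) (nbhd x).
    by left; exact: sqr_ge0.
  have [le|lt] := leP (- g v) (g x); last by right; exists v.
  by left; rewrite ler_sqr ?nnegrE // ltW.
- have M't : t * (1 - t) * max_on (fun y => sqr_pos (- g y)) (nbhd x)
      <= t * (1 - t) * g x ^+ 2.
    by rewrite ler_wpM2l // mulr_ge0 //; lra.
  have [ME|[u uN [gu ME]]] := max_sqr_pos_cases g (nbhd x); rewrite ME.
    have tq : 0 <= (1 + t) * (edge_energy g x * (d%:R - 1) / d%:R).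
      by rewrite mulr_ge0 //; lra.
    have ta : 0 <= t ^+ 2 * (1 - t) * g x ^+ 2 by rewrite !mulr_ge0 ?sqr_ge0 //; lra.
    rewrite mulr0 add0r; apply: (le_trans M't); rewrite -subr_ge0.
    rewrite [leRHS](_ : _ = t ^+ 2 * (1 - t) * g x ^+ 2
      + (1 + t) * (edge_energy g x * (d%:R - 1) / d%:R)); last by ring.
    exact: addr_ge0.
  apply: (le_trans _ (local_inequality_same t d%:R mu (g x) (g u) _ t0 t1 D3 mu1 a0 (ltW gu) _)).
    by rewrite lerD2l.
  apply: le_trans (one _ uN); rewrite le_eqVlt; apply/orP; left; apply/eqP.
  by rewrite /F; ring.
rewrite M'E; pose m := - g v - g x.
have m0 : 0 <= m by rewrite /m; lra.
have -> : - g v = g x + m by rewrite /m; ring.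
have [ME|[u uN [gu ME]]] := max_sqr_pos_cases g (nbhd x); rewrite ME.
  rewrite mulr0 add0r; apply: (local_inequality_opp t d%:R mu) => //.
  apply: le_trans (one _ vN); rewrite le_eqVlt; apply/orP; left; apply/eqP.
  by rewrite /F /m; ring.
apply: (local_inequality_two t d%:R mu) => //; first exact: ltW.
have uv : u != v by apply/eqP => uv; move: gu gv a0; rewrite uv; lra.
apply: le_trans (two _ _ uN vN uv); rewrite le_eqVlt; apply/orP; left; apply/eqP.
by rewrite /F /m; ring.
Qed.

(** The total weight of the superlevel sets meeting [A], for the sign given by [b]. *)
Definition signed_max {R : realFieldType} {T : finType} (g : T -> R) (b : bool) (A : {set T}) : R :=
  max_on (fun y => sqr_pos ((-1) ^+ b * g y)) A.

Lemma signed_maxN {R : realFieldType} {T : finType} (g : T -> R) (b : bool) (A : {set T}) :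
  signed_max (fun y => - g y) b A = signed_max g (~~ b) A.
Proof.
by apply: eq_bigr => y _; case: b; rewrite /= expr1 expr0 ?mulN1r ?mul1r ?opprK.
Qed.

(** Up to an error term to be summed over [x], this says that selection has at least [(1 - t) / 2]
    times the weight of decision. Negating [g] swaps the signs, so [g x >= 0] may be assumed; then
    only the positive sign can select [x]. *)
Lemma vertex_rounding {R : realFieldType} {G : sgraph} (d : nat) (mu t : R)
    (g : G -> R) (x : G) :
  (3 <= d)%N -> regular G d -> 0 < t -> t < 1 -> 0 <= mu -> mu <= 1 ->
  \sum_(u in nbhd x) g u = (mu - d%:R) * g x ->
  t * (1 - t) * \sum_(b : bool) signed_max g b (x |: nbhd x)
    + (1 + t) * (t ^+ 2 * g x ^+ 2 - edge_energy g x * (d%:R - 1) / d%:R)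
  <= 2 * t * \sum_(b : bool) (signed_max g b (x |: nbhd x) - signed_max g b (nbhd x)).
Proof.
move=> d3 reg t0 t1 mu0 mu1.
wlog gx : g / 0 <= g x => [hw|] eig.
  have [/hw/(_ eig)//|/ltW gx] := leP 0 (g x).
  have := hw (fun y => - g y); rewrite oppr_ge0 gx => /(_ isT).
  rewrite sumrN eig mulrN => /(_ erefl).
  have -> : edge_energy (fun y => - g y) x = edge_energy g x.
    by apply: eq_bigr => u _; rewrite -opprD sqrrN.
  rewrite !big_bool /= !signed_maxN /= sqrrN.
  by move=> H; apply: etrans H; congr (_ <= _); ring.
rewrite !big_bool /=.
have M1 A : signed_max g true A = max_on (fun y => sqr_pos (- g y)) A.
  by apply: eq_bigr => y _; rewrite expr1 mulN1r.
have M0 A : signed_max g false A = max_on (fun y => sqr_pos (g y)) A.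
  by apply: eq_bigr => y _; rewrite expr0 mul1r.
rewrite !M1 !M0.
rewrite !max_onU1 ?sqr_pos_ge0 //= (sqr_pos_ge (g x)) // (sqr_pos_le (- g x)) ?oppr_le0 //.
rewrite (max_r (max_on_ge0 _ _)).
have := vertex_inequality d mu t g x d3 reg t0 t1 mu0 mu1 gx eig.
set m := max_on _ _; set m' := max_on _ _; set q := _ * _ / _ => H.
have : t * (1 + t) * g x ^+ 2 <= t * (1 + t) * Num.max (g x ^+ 2) m.
  by rewrite ler_wpM2l ?le_max ?lexx // mulr_ge0 //; lra.
set X := Num.max _ _ => HX.
rewrite -subr_ge0.
rewrite [leRHS](_ : _ = (t * (1 + t) * X - t * (1 + t) * g x ^+ 2)
  + (t * (1 - t ^+ 2) * g x ^+ 2 + (1 + t) * q - (2 * t * m + t * (1 - t) * m'))).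
  by rewrite addr_ge0 // subr_ge0.
by ring.
Qed.

(** * Summation over the vertices *)

Lemma sum_adj_nbhd {R : realFieldType} {G : sgraph} (d : nat) (F : G -> R) :
  regular G d -> \sum_x \sum_(u in nbhd x) F u = d%:R * \sum_x F x.
Proof.
move=> reg.
rewrite (exchange_big_dep predT) //= mulr_sumr; apply: eq_bigr => u _.
rewrite (eq_bigl (fun y => y \in nbhd u)) => [|y]; last by rewrite !inE adj_sym.
by rewrite sumr_const (reg u) mulr_natl.
Qed.

Lemma sum_edge_energy {R : realFieldType} {G : sgraph} (d : nat) (mu : R) (f : G -> R) :
  regular G d -> (forall x, \sum_(u in nbhd x) f u = (mu - d%:R) * f x) ->
  \sum_x edge_energy f x = 2 * mu * \sum_x f x ^+ 2.
Proof.
move=> reg eig.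
have E x : edge_energy f x = \sum_(u in nbhd x) f u ^+ 2 + (2 * mu - d%:R) * f x ^+ 2.
  rewrite /edge_energy (eq_bigr (fun u => f u ^+ 2 + (2 * f x * f u + f x ^+ 2))); last first.
    by move=> u _; ring.
  rewrite !big_split /= -mulr_sumr eig sumr_const (reg x) -(mulr_natl (f x ^+ 2)).
  by ring.
rewrite (eq_bigr _ (fun x _ => E x)) big_split /= (sum_adj_nbhd d) // -mulr_sumr.
by ring.
Qed.

Lemma indep_number_ge {R : realFieldType} {G : sgraph} (d : nat) (mu t : R) (f : G -> R) :
  (3 <= d)%N -> regular G d -> vertex_transitive G -> 0 < t -> t < 1 ->
  (exists x, f x != 0) ->
  (forall x, \sum_(u in nbhd x) f u = (mu - d%:R) * f x) ->
  2 * mu * (d%:R - 1) <= t ^+ 2 * d%:R ->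
  (1 - t) / 2 * #|G|%:R <= (indep_number G)%:R.
Proof.
move=> d3 reg trG t0 t1 [x0 fx0] eig mut.
have D3 : 3 <= d%:R :> R by rewrite ler_nat.
have f2 : 0 < \sum_x f x ^+ 2.
  rewrite (bigD1 x0) //= ltr_pwDl ?exprn_even_gt0 //.
  by apply: sumr_ge0 => x _; exact: sqr_ge0.
have energy := sum_edge_energy d mu f reg eig.
have mu0 : 0 <= mu.
  have : 0 <= 2 * mu * \sum_x f x ^+ 2.
    by rewrite -energy; do 2!apply: sumr_ge0 => ? _; exact: sqr_ge0.
  by rewrite pmulr_lge0 // pmulr_rge0.
(* The hypothesis [mut] gives [mu <= d / (2 * (d - 1))], which is at most 3/4. *)
have mu1 : mu <= 1.
  have : t ^+ 2 * d%:R <= d%:R by rewrite ler_piMl // expr_le1 ?ltW.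
  nra.
pose M := signed_max f.
pose W := (bool * {perm G})%type.
have [p p_ge0 pE] : exists2 p : W -> {set G} -> R, (forall w S, 0 <= p w S) &
    forall w (A : {set G}), \sum_(S : {set G} | ~~ [disjoint S & A]) p w S = M w.1 (w.2 @: A).
  pose layers (w : W) (q : {set G} -> R) := (forall S, 0 <= q S) /\
    forall A : {set G}, \sum_(S : {set G} | ~~ [disjoint S & A]) q S = M w.1 (w.2 @: A).
  have [|p Hp] := @fin_all_exists W (fun=> {set G} -> R) layers.
    move=> [b s]; have [q q0 qE] := layer_cake
      ((fun y => sqr_pos ((-1) ^+ b * f y)) \o s) (fun y => sqr_pos_ge0 _).
    by exists q; split=> // A; rewrite qE /M /signed_max max_on_imset.
  by exists p => w; have [] := Hp w.
(* The unnormalised law of S, mixing over both signs and all automorphisms. *)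
pose P S := \sum_(w : W | w.2 \in graph_aut G) p w S.
(* Stated for any equivariant [N], to serve both open and closed neighbourhoods. *)
have hitE (N : G -> {set G}) (v : G) :
    (forall s x, s \in graph_aut G -> N (s x) = s @: N x) ->
    #|G|%:R * \sum_(S : {set G} | ~~ [disjoint S & N v]) P S
    = #|graph_aut G|%:R * \sum_x \sum_(b : bool) M b (N x).
  move=> Ns; rewrite -(sum_graph_aut _ v trG) exchange_big /=; congr (_ * _).
  rewrite (eq_bigr _ (fun w _ => pE w _)).
  rewrite [RHS]exchange_big /= pair_big_dep /=.
  by apply: eq_big => [w|w sG] //; rewrite Ns.
have G0 : 0 < #|G|%:R :> R by rewrite ltr0n; apply/card_gt0P; exists x0.
have Aut0 : 0 < #|graph_aut G|%:R :> R by rewrite ltr0n cardG_gt0.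
have N1 (s : {perm G}) (x : G) : s \in graph_aut G -> nbhd (s x) = s @: nbhd x.
  exact: nbhd_graph_aut.
have N2 (s : {perm G}) (x : G) : s \in graph_aut G -> s x |: nbhd (s x) = s @: (x |: nbhd x).
  by move=> sG; rewrite imsetU1 N1.
have [|v|v|I [_ iI cI]] := greedy_independent P ((1 - t) / 2) _ _ _ [set: G].
- by move=> S; apply: sumr_ge0.
- rewrite -(pmulr_rgt0 _ G0) (hitE (fun x => x |: nbhd x)) // pmulr_rgt0 //.
  apply: lt_le_trans f2 _; apply: ler_sum => x _.
  rewrite big_bool /M /signed_max !max_onU1 ?sqr_pos_ge0 //= expr0 expr1 mulN1r mul1r.
  have [fx|/ltW fx] := leP 0 (f x).
    by apply: ler_wpDl; rewrite le_max ?sqr_pos_ge0 // sqr_pos_ge // lexx.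
  by apply: ler_wpDr; rewrite le_max ?sqr_pos_ge0 // sqr_pos_ge ?oppr_ge0 // sqrrN lexx.
- rewrite -(ler_pM2l G0) mulrBr mulrCA !(hitE (fun x => x |: nbhd x)) // !(hitE nbhd) //.
  rewrite -mulrBr mulrCA ler_pM2l // -(ler_pM2l (x := 2 * t)); last by rewrite mulr_gt0.
  rewrite -sumrB.
  have -> : 2 * t * ((1 - t) / 2 * \sum_x \sum_(b : bool) M b (x |: nbhd x))
     = \sum_x t * (1 - t) * \sum_(b : bool) M b (x |: nbhd x).
    by rewrite -mulr_sumr; field.
  rewrite mulr_sumr.
  (* The error terms add up to [1 + t] times [t ^+ 2 - 2 * mu * (d - 1) / d] times the sum of the
     squares of [f]; [mut] is the condition that this be nonnegative. *)
  have tot : 0 <= \sum_x (1 + t) * (t ^+ 2 * f x ^+ 2 - edge_energy f x * (d%:R - 1) / d%:R).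
    rewrite -mulr_sumr mulr_ge0 //; first by lra.
    rewrite sumrB -mulr_sumr -!mulr_suml energy subr_ge0.
    rewrite ler_pdivrMr; last by lra.
    by rewrite mulrAC [leRHS]mulrAC ler_pM2r.
  apply: (le_trans (y := \sum_x (t * (1 - t) * \sum_(b : bool) M b (x |: nbhd x)
    + (1 + t) * (t ^+ 2 * f x ^+ 2 - edge_energy f x * (d%:R - 1) / d%:R)))).
    by rewrite big_split /= lerDl.
  apply: ler_sum => x _; rewrite -sumrB.
  exact: (vertex_rounding d mu t f x).
rewrite cardsT in cI; apply: le_trans cI _.
by rewrite ler_nat indep_number_max.
Qed.

(* Bounds on the independence ratio and the limit *)
From mathcomp Require Import all_classical all_reals all_analysis.
Import numFieldNormedType.Exports.

Lemma adjmx_eigenvector {R : realType} {G : sgraph} (lam : R) :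
  eigenvalue (adjmx R G) lam ->
  exists2 f : G -> R, (exists x, f x != 0) &
    forall x, \sum_(u in nbhd x) f u = lam * f x.
Proof.
move=> /eigenvalueP[v vA v0].
exists (fun x => v ord0 (enum_rank x)).
  have /rV0Pn[i vi] := v0.
  by exists (enum_val i); rewrite enum_valK.
move=> x; have /rowP/(_ (enum_rank x)) := vA; rewrite !mxE => <-.
rewrite big_mkcond (reindex (@enum_val G predT)) /=; last first.
  exact: onW_bij (enum_val_bij G).
apply: eq_bigr => j _; rewrite enum_valK mxE enum_rankK inE adj_sym.
by case: (adj _ _); rewrite ?mulr1 ?mulr0.
Qed.

Lemma indep_ratio_ge {R : realType} {G : sgraph} (d : nat) (lam : R) :
  (3 <= d)%N -> regular G d -> vertex_transitive G ->
  eigenvalue (adjmx R G) lam ->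
  1 / 2 - 1 / 3 * Num.sqrt (d%:R * (lam + d%:R)) <= indep_ratio R G.
Proof.
move=> d3 reg trG /adjmx_eigenvector[f f0 eig].
have D3 : 3 <= d%:R :> R by rewrite ler_nat.
have G0 : 0 < #|G|%:R :> R.
  by case: f0 => x _; rewrite ltr0n; apply/card_gt0P; exists x.
set mu := lam + d%:R; set s := Num.sqrt _.
have s0 : 0 <= s by exact: sqrtr_ge0.
(* Only an inequality, because [Num.sqrt] is 0 at negative arguments. *)
have smu : d%:R * mu <= s ^+ 2.
  have [mu0|mu0] := leP 0 (d%:R * mu); first by rewrite sqr_sqrtr.
  by rewrite (le_trans (ltW mu0)) ?sqr_ge0.
have ge_t t : 2 / 3 * s < t -> t < 1 -> (1 - t) / 2 <= indep_ratio R G.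
  move=> st t1; rewrite ler_pdivlMr //.
  have t0 : 0 < t by lra.
  apply: (indep_number_ge d mu t f) => //.
    by move=> x; rewrite eig /mu addrK.
  have [mu0|mu0] := leP 0 mu; last first.
    apply: (@le_trans _ _ 0); last by rewrite mulr_ge0 ?sqr_ge0.
    by rewrite mulr_le0_ge0 //; lra.
  have s2 : 4 / 9 * s ^+ 2 <= t ^+ 2.
    rewrite [leLHS](_ : _ = (2 / 3 * s) ^+ 2); last by field.
    by rewrite ler_sqr ?nnegrE //; lra.
  apply: (@le_trans _ _ (4 / 9 * (d%:R * mu) * d%:R)); last first.
    by rewrite ler_pM2r; lra.
  (* The constant 2/3 is sharp at [d = 3], where the factor [d - 3] vanishes. *)
  rewrite -subr_ge0.
  rewrite [leRHS](_ : _ = 2 / 9 * mu * ((2 * d%:R - 3) * (d%:R - 3))); last by field.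
  by rewrite !mulr_ge0 //; lra.
(* For [2 / 3 * s >= 1] the claimed bound is at most 0. Otherwise [t] tends to [2 / 3 * s] from
   above, and the midpoint with 1 keeps it below 1. *)
have [s1|s1] := leP 1 (2 / 3 * s).
  by apply: (@le_trans _ _ 0); [lra | rewrite divr_ge0].
apply/ler_addgt0Pr => e e0.
have := ge_t (Num.min (2 / 3 * s + e) ((2 / 3 * s + 1) / 2)).
rewrite lt_min gt_min => /(_ _ _); set t := Num.min _ _ => H.
have te : t <= 2 / 3 * s + e by rewrite ge_min lexx.
suff : (1 - t) / 2 <= indep_ratio R G by lra.
by apply: H; lra.
Qed.

(** All [#|A| * d] edges at [A] end in the complement, which can receive at most [d] per vertex. *)
Lemma indep_number_le {G : sgraph} (d : nat) (A : {set G}) :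
  (0 < d)%N -> regular G d -> independent A -> (#|A|.*2 <= #|G|)%N.
Proof.
move=> d0 reg /independentP iA.
have deg (x : G) : (\sum_(y : G) adj x y)%N = d.
  by rewrite -[RHS](reg x) -sum1_card [RHS]big_mkcond; apply: eq_bigr => y _; rewrite inE; case: adj.
have E : (#|A| * d <= #|~: A| * d)%N.
  rewrite -!sum_nat_const.
  rewrite -[leqLHS](eq_bigr _ (fun x _ => deg x)) -[leqRHS](eq_bigr _ (fun x _ => deg x)).
  rewrite [leqRHS](eq_bigr (fun y => \sum_x adj x y)%N); last first.
    by move=> y _; apply: eq_bigr => x _; rewrite adj_sym.
  rewrite [leqRHS]exchange_big /= [leqRHS](bigID (mem A)) /=.
  apply: leq_trans (leq_addr _ _); apply: leq_sum => x xA.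
  rewrite (bigID (mem A)) /= big1 ?add0n => [|y yA]; last by rewrite (negPf (iA x y xA yA)).
  by apply: eq_leq; apply: eq_bigl => y; rewrite inE.
rewrite leq_pmul2r in E; last by [].
by rewrite -addnn -(cardsC A) leq_add2l.
Qed.

Lemma indep_ratio_le {R : realType} {G : sgraph} (d : nat) :
  (0 < d)%N -> regular G d -> (0 < #|G|)%N -> indep_ratio R G <= 1 / 2.
Proof.
move=> d0 reg G0; rewrite ler_pdivrMr ?ltr0n //.
have : ((indep_number G).*2 <= #|G|)%N.
  rewrite /indep_number; elim/big_ind: _ => // [m n|A]; last exact: (indep_number_le d).
  by rewrite /maxn; case: ifP.
by rewrite -(ler_nat R) -mul2n natrM; lra.
Qed.

Local Open Scope classical_set_scope.
Local Open Scope ring_scope.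

Theorem theorem1 (R : realType) (d : nat) (hd : (3 <= d)%N) :
  (forall (G : sgraph) (lam : R),
      regular G d -> vertex_transitive G ->
      least_eigenvalue (adjmx R G) lam ->
      1 / 2 - 1 / 3 * Num.sqrt (d%:R * (lam + d%:R)) <= indep_ratio R G)
  /\
  (forall (G : nat -> sgraph) (lam : nat -> R),
      (forall n, regular (G n) d) ->
      (forall n, vertex_transitive (G n)) ->
      (forall n, least_eigenvalue (adjmx R (G n)) (lam n)) ->
      lam n @[n --> \oo] --> - (d%:R : R) ->
      indep_ratio R (G n) @[n --> \oo] --> (1 / 2 : R)).
Proof.
split=> [G lam reg trG [eig _]|G lam reg trG least lamd].
  exact: indep_ratio_ge.
pose low n := 1 / 2 - 1 / 3 * Num.sqrt (d%:R * (lam n + d%:R)).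
have low_cvg : low n @[n --> \oo] --> (1 / 2 : R).
  have gap : d%:R * (lam n + d%:R) @[n --> \oo] --> (0 : R).
    rewrite -(mulr0 d%:R) -(addNr d%:R).
    by apply: cvgM; [exact: cvg_cst | apply: cvgD => //; exact: cvg_cst].
  have -> : 1 / 2 = 1 / 2 - 1 / 3 * Num.sqrt 0 :> R by rewrite sqrtr0 mulr0 subr0.
  apply: cvgB; first exact: cvg_cst.
  apply: cvgM; first exact: cvg_cst.
  by apply: (cvg_comp _ _ gap); exact: (@sqrt_continuous R 0).
apply: (@squeeze_cvgr _ _ _ _ low (fun=> 1 / 2 : R)); [|exact: low_cvg|exact: cvg_cst].
near=> n; apply/andP; split.
  by apply: indep_ratio_ge => //; have [] := least n.
apply: (@indep_ratio_le _ _ d) => //; first exact: leq_trans hd.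
(* Transitivity supplies a vertex, so the ratio has a nonzero denominator. *)
by have /imsetP[x _ _] := trG n; apply/card_gt0P; exists x.
Unshelve. all: by end_near.
Qed.
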